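(* For any graph $G$, $\mathrm{M}_+^{\mathbb{C}}(G)\le \mathrm{Z}_+(G)$.
   Context: A graph $G=(V_G,E_G)$ is a finite simple undirected graph with nonempty vertex set. Let $n=|V_G|$, with $V_G$ identified with $\{1,\dots,n\}$. For an $n\times n$ Hermitian matrix $A$, the graph $\mathcal{G}(A)$ has vertices $\{1,\dots,n\}$ and edges $\{i,j\}$, $i<j$, exactly when $a_{ij}\neq 0$ (the diagonal is ignored). $\mathcal{H}_+(G)$ is the set of complex Hermitian positive semidefinite $n\times n$ matrices $A$ with $\mathcal{G}(A)=G$, and $\mathrm{M}_+^{\mathbb{C}}(G)=\max\{\dim\ker A: A\in\mathcal{H}_+(G)\}$. Positive semidefinite color change rule: let $B$ be the set of all currently black vertices (all other vertices are white), and let $W_1,\dots,W_k$ be the vertex sets of the connected components of $G-B$ (possibly $k=1$). If $u\in B$, $w\in W_i$, and $w$ is the only white neighbor of $u$ in the induced subgraph $G[W_i\cup B]$, then change the color of $w$ to black. A positive semidefinite zero forcing set is a set $X\subseteq V_G$ such that, starting with exactly the vertices of $X$ black and applying this rule repeatedly (recomputing $B$ and the components each time) until no more changes are possible, all vertices become black. $\mathrm{Z}_+(G)$ is the minimum of $|X|$ over all positive semidefinite zero forcing sets $X$. *)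

(* Defs.v *)
From HB Require Import structures.
From mathcomp Require Import all_boot all_order all_algebra.
From mathcomp Require Import boolp reals.
From mathcomp Require Import complex.
Set Implicit Arguments.
Unset Strict Implicit.
Unset Printing Implicit Defensive.
Import Order.TTheory GRing.Theory Num.Theory.
Local Open Scope ring_scope.
Local Open Scope sesquilinear_scope.

Record sgraph (n : nat) := SGraph {
  adj :> rel 'I_n;
  adj_sym : symmetric adj;
  adj_irrefl : irreflexive adj
}.

Definition mx_adj (C : numClosedFieldType) n (A : 'M[C]_n) : rel 'I_n :=
  [rel i j | (i != j) && (A i j != 0)].

(* In a numClosedFieldType, [0 <= z] entails that z is real. *)
Definition psdmx (C : numClosedFieldType) n (A : 'M[C]_n) : Prop :=
  A \is hermsymmx /\ forall v : 'cV[C]_n, 0 <= (v ^t* *m A *m v) 0 0.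

Definition Hplus (C : numClosedFieldType) n (G : sgraph n) (A : 'M[C]_n) : Prop :=
  psdmx A /\ mx_adj A =2 adj G.

(* [cokermx A] spans the column kernel {v | A *m v = 0}, whereas [kermx A] is
   the row kernel. *)
Definition nullity (C : numClosedFieldType) n (A : 'M[C]_n) : nat :=
  \rank (cokermx A).

(* Always a maximum over a nonempty set: see [Mplus_attained]. *)
Definition Mplus (C : numClosedFieldType) n (G : sgraph n) : nat :=
  (\max_(k < n.+1 | `[< exists2 A : 'M[C]_n, Hplus G A & nullity A = k >]) k)%N.

Section ZeroForcing.
Variables (n : nat) (G : sgraph n).
Implicit Types B W X : {set 'I_n}.

Definition minus_adj B : rel 'I_n :=
  [rel x y | [&& x \notin B, y \notin B & G x y]].

Definition components B : {set {set 'I_n}} :=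
  equivalence_partition (connect (minus_adj B)) (~: B).

Definition psd_force B W (u w : 'I_n) : bool :=
  [&& W \in components B, u \in B, w \in W &
      [set v in W :|: B | (v \notin B) && G u v] == [set w]].

Definition psd_step : rel {set 'I_n} := fun B B' =>
  [exists W, exists u, exists w, psd_force B W u w && (B' == w |: B)].

(* Some run of the process blackens every vertex; by [psd_zfsP] this is the same
   as every exhaustive run doing so. *)
Definition psd_zfs X : bool := connect psd_step X [set: 'I_n].

(* The default [set: 'I_n] is itself a zero forcing set: see [psd_zfsT]. *)
Definition Zplus : nat :=
  #|[arg min_(X < [set: 'I_n] | psd_zfs X) #|X| ]|.

Lemma psd_zfsT : psd_zfs [set: 'I_n].
Proof. exact: connect0. Qed.

Lemma minus_adj_csym B : connect_sym (minus_adj B).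
Proof.
apply: sym_connect_sym => x y /=.
by rewrite /minus_adj /= (adj_sym G); case: (x \in B); case: (y \in B).
Qed.

Lemma componentsP B W :
  reflect (exists2 x, x \notin B &
             W = [set y in ~: B | connect (minus_adj B) x y])
          (W \in components B).
Proof.
apply: (iffP imsetP) => [[x xB ->]|[x xB ->]]; exists x => //.
- by rewrite in_setC in xB.
- by rewrite in_setC.
Qed.

Lemma psd_force_white B W u w : psd_force B W u w -> w \notin B.
Proof.
case/and4P=> /componentsP[x xB ->] _ wW _.
by move: wW; rewrite !inE => /andP[].
Qed.

Lemma psd_step_sub B B' : psd_step B B' -> B \subset B'.
Proof.
case/existsP=> W /existsP[u /existsP[w /andP[_ /eqP ->]]]; exact: subsetUr.
Qed.

Lemma psd_force_mono B B' W u w : B \subset B' -> w \notin B' ->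
  psd_force B W u w -> exists W', psd_force B' W' u w.
Proof.
move=> sBB' wB' /and4P[/componentsP[x xB defW] uB wW /eqP eqW].
exists [set y in ~: B' | connect (minus_adj B') w y].
have sW : {in [set y in ~: B' | connect (minus_adj B') w y], forall y, y \in W}.
  move=> y; rewrite !inE => /andP[yB' wy]; move: wW; rewrite defW !inE.
  move=> /andP[wB xw]; apply/andP; split.
    by apply: contra yB'; apply: (subsetP sBB').
  apply: connect_trans xw _; apply: connect_sub wy => a b /and3P[aB bB ab].
  apply: connect1; rewrite /minus_adj /= ab andbT; apply/andP; split.
    by apply: contra aB; apply: (subsetP sBB').
  by apply: contra bB; apply: (subsetP sBB').
have wu : G u w by move/setP/(_ w): eqW; rewrite !inE eqxx => /andP[_ /andP[]].
apply/and4P; split.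
- by apply/componentsP; exists w.
- exact: (subsetP sBB').
- by rewrite !inE wB' connect0.
apply/eqP/setP=> v; rewrite !inE; apply/idP/eqP => [|->]; last first.
  by rewrite wB' connect0 wu.
case/andP=> vW /andP[vB' uv].
have {}vW : v \in W.
  by case/orP: vW => [vW|/(negP vB') //]; apply: sW; rewrite !inE.
have vB : v \notin B by apply: contra vB'; apply: (subsetP sBB').
by move/setP/(_ v): eqW; rewrite !inE vW vB uv => /esym/eqP.
Qed.

Lemma psd_step_force B W u w : psd_force B W u w -> psd_step B (w |: B).
Proof.
move=> f; apply/existsP; exists W; apply/existsP; exists u.
by apply/existsP; exists w; rewrite f eqxx.
Qed.

Definition psd_terminal B : Prop := forall B', ~~ psd_step B B'.

Lemma psd_connect_terminal B : exists2 B', connect psd_step B B' & psd_terminal B'.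
Proof.
have [m] := ubnP #|~: B|; elim: m B => // m IHm B leBm.
have [/existsP[B' st]|] := boolP [exists B', psd_step B B']; last first.
  by rewrite negb_exists => /forallP tB; exists B.
have [|D cD tD] := IHm B'; last first.
  by exists D => //; apply: connect_trans (connect1 st) cD.
case/existsP: st => W /existsP[u /existsP[w /andP[f /eqP ->]]].
rewrite -ltnS; apply: leq_trans leBm; rewrite ltnS; apply: proper_card.
rewrite setCU setIC -setDE properD1 // in_setC; exact: psd_force_white f.
Qed.

Lemma psd_zfsP X : psd_zfs X <->
  forall B, connect psd_step X B -> psd_terminal B -> B = [set: 'I_n].
Proof.
split=> [zX B cB tB|all]; last first.
  by have [B cB /(all _ cB) eB] := psd_connect_terminal X; rewrite /psd_zfs -eB.
have sXB : X \subset B.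
  case/connectP: cB => p pp ->; elim: p X pp {zX tB} => [|Y p IHp] X //=.
  by case/andP=> /psd_step_sub sXY /IHp; apply: subset_trans.
apply/eqP; rewrite -subTset.
case/connectP: zX => p pp eT; rewrite {1}eT.
elim: p X sXB pp {eT cB} => [|Y p IHp] X sXB //=.
case/andP=> st; apply: IHp.
case/existsP: st => W /existsP[u /existsP[w /andP[f /eqP ->]]].
rewrite subUset sXB andbT sub1set; apply/negPn/negP => wB.
have [W' f'] := psd_force_mono sXB wB f.
by have := tB (w |: B); rewrite (psd_step_force f').
Qed.

End ZeroForcing.

Section Attained.
Variables (C : numClosedFieldType) (n : nat) (G : sgraph n).

Lemma Hplus_nonempty : exists A : 'M[C]_n, Hplus G A.
Proof.
pose A : 'M[C]_n := \matrix_(i, j)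
  ((G i j)%:R + (i == j)%:R * \sum_k (G i k)%:R).
exists A; split; [split|].
- apply/is_hermitianmxP; rewrite expr0 scale1r; apply/matrixP=> i j.
  rewrite !mxE rmorphD rmorphM rmorph_sum /= !conjC_nat adj_sym eq_sym.
  congr (_ + _); case: eqP => [->|_]; last by rewrite !mul0r.
  by congr (_ * _); apply: eq_bigr => k _; rewrite conjC_nat.
- move=> v; pose x i := v i 0.
  pose S := \sum_i \sum_j (G i j)%:R * ((x i)^* * x j + (x i)^* * x i).
  have -> : (v ^t* *m A *m v) 0 0 = S.
    rewrite mxE; under eq_bigr => j _ do rewrite mxE mulr_suml.
    rewrite exchange_big /=; apply: eq_bigr => i _.
    under eq_bigr => j _ do rewrite !mxE mulrDr mulrDl.
    under [RHS]eq_bigr => j _ do rewrite mulrDr.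
    rewrite !big_split /=; congr (_ + _).
      by apply: eq_bigr => j _; rewrite mulrCA mulrA.
    rewrite (bigD1 i) //= eqxx mul1r [X in _ + X]big1 ?addr0; last first.
      by move=> j; rewrite eq_sym => /negPf ->; rewrite mul0r mulr0 mul0r.
    by rewrite -mulr_suml mulrCA mulrA.
  have S2 : S + S = \sum_i \sum_j (G i j)%:R * ((x i + x j)^* * (x i + x j)).
    rewrite {2}/S exchange_big /S /= -big_split; apply: eq_bigr => i _ /=.
    rewrite -big_split; apply: eq_bigr => j _ /=.
    rewrite (adj_sym G j i) -mulrDr; congr (_ * _).
    by rewrite rmorphD mulrDl !mulrDr [X in X + _]addrC.
  have : 0 <= S + S.
    rewrite S2; apply: sumr_ge0 => i _; apply: sumr_ge0 => j _.
    by apply: mulr_ge0; rewrite ?ler0n // mulrC mul_conjC_ge0.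
  by rewrite -mulr2n pmulrn_lge0.
move=> i j; rewrite /mx_adj /= mxE; have [->|ij] := eqVneq i j.
  by rewrite (adj_irrefl G).
by rewrite mul0r addr0; case: (G i j); rewrite ?oner_eq0 ?eqxx.
Qed.

Lemma nullity_le (A : 'M[C]_n) : (nullity A < n.+1)%N.
Proof. exact: rank_leq_row. Qed.

Lemma Mplus_attained : exists2 A : 'M[C]_n, Hplus G A & nullity A = Mplus C G.
Proof.
have [A0 HA0] := Hplus_nonempty.
pose P (k : 'I_n.+1) := `[< exists2 A : 'M[C]_n, Hplus G A & nullity A = k >].
have P0 : P (Ordinal (nullity_le A0)) by apply/asboolP; exists A0.
have [k /asboolP[A HA eA] ek] : {k | P k & Mplus C G = k}.
  apply: eq_bigmax_cond; apply/card_gt0P.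
  by exists (Ordinal (nullity_le A0)).
by exists A => //; rewrite eA ek.
Qed.

Lemma nullity_le_Mplus (A : 'M[C]_n) : Hplus G A -> (nullity A <= Mplus C G)%N.
Proof.
move=> HA; pose k := Ordinal (nullity_le A).
by rewrite -[nullity A]/(val k); apply: leq_bigmax_cond; apply/asboolP; exists A.
Qed.

End Attained.

(* Main.v *)
Require Import Defs.
From mathcomp Require Import all_boot all_order all_algebra.
From mathcomp Require Import reals complex.
From mathcomp Require Import ring.
Set Implicit Arguments.
Unset Strict Implicit.
Unset Printing Implicit Defensive.
Import Order.TTheory GRing.Theory Num.Theory.
Local Open Scope ring_scope.
Local Open Scope sesquilinear_scope.

(** Let [A] be positive semidefinite with graph [G], and let [v] be a kernel
vector of [A] vanishing on the black set [B]. If [v'] is the restriction of [v]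
to a white component [W], then [A v'] vanishes on [W], because the rows of [W]
see only [W] and [B]; hence [v'^* A v' = 0], and so [A v' = 0] by
semidefiniteness. If [u] forces [w] in [W], row [u] of this equation reads
[A u w * v w = 0], so [v w = 0]. Therefore a kernel vector vanishing on a zero
forcing set [X] is zero, and restriction to [X] embeds the kernel in [C^X]. *)

Section Kernel.
Variables (C : numClosedFieldType) (n : nat).
Implicit Types (A : 'M[C]_n) (v : 'cV[C]_n).

Lemma dotmx_ge0 v : 0 <= (v ^t* *m v) 0 0.
Proof.
by rewrite mxE; apply: sumr_ge0 => i _; rewrite !mxE mulrC mul_conjC_ge0.
Qed.

Lemma dotmx_eq0 v : (v ^t* *m v) 0 0 = 0 -> v = 0.
Proof.
rewrite mxE => /eqP; rewrite psumr_eq0 => [/allP v0|i _]; last first.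
  by rewrite !mxE mulrC mul_conjC_ge0.
apply/matrixP => i j; rewrite ord1 [RHS]mxE; apply/eqP.
by have := v0 i (mem_index_enum _); rewrite !mxE mulrC mul_conjC_eq0.
Qed.

(** A nonnegative form cannot decrease to first order at one of its zeros, and moving from [v] along
    [- A *m v] would decrease it at twice the squared norm of [A *m v]. *)
Lemma psdmx_form_eq0 A v :
  psdmx A -> (v ^t* *m A *m v) 0 0 = 0 -> A *m v = 0.
Proof.
case=> /is_hermitianmxP; rewrite expr0 scale1r => hA psdA qv0.
pose z := A *m v; apply: dotmx_eq0; rewrite -/z.
set c : C := (z ^t* *m z) 0 0; pose d : C := (z ^t* *m A *m z) 0 0.
have c_ge0 : 0 <= c by exact: dotmx_ge0.
have d_ge0 : 0 <= d by exact: psdA.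
have zE : z ^t* = v ^t* *m A.
  by rewrite /z trmx_mul map_mxM -hA.
(* For real [t] the form at [t *: v - c *: z] is [c ^+ 2 * (d - 2 * t)]; the choice [t = d + 1]
   makes the last factor negative without any division. *)
pose x : 'cV[C]_n := (d + 1) *: v - c *: z.
(* The form is negative at [x] unless [c = 0]. *)
have qx : (x ^t* *m A *m x) 0 0 = - (c ^+ 2 * (d + 2)).
  have -> : x ^t* = (d + 1) *: v ^t* - c *: z ^t*.
    apply/matrixP => i j; rewrite !mxE rmorphB !rmorphM rmorphD rmorph1 /=.
    by rewrite (geC0_conj d_ge0) (geC0_conj c_ge0).
  rewrite /x !(mulmxBl, mulmxBr) -!(scalemxAl, scalemxAr).
  have e1 : v ^t* *m A *m z = z ^t* *m z by rewrite zE.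
  have e2 : z ^t* *m A *m v = z ^t* *m z by rewrite -mulmxA.
  rewrite e1 e2 -/d; move: qv0 (erefl c) (erefl d); rewrite {2}/c {2}/d.
  set M1 := _ *m v; set M2 := _ *m z; set M3 := _ *m A *m z.
  by rewrite !mxE => -> <- <-; ring.
have := psdA x; rewrite qx oppr_ge0 => le0.
have : c ^+ 2 * (d + 2) == 0.
  by rewrite eq_le le0 mulr_ge0 ?exprn_ge0 ?addr_ge0.
rewrite mulf_eq0 sqrf_eq0 => /orP[/eqP //|].
by rewrite gt_eqF // ltr_wpDl.
Qed.

Variable G : sgraph n.
Implicit Types B W X : {set 'I_n}.

Lemma psd_force_kernel A v B W u w : Hplus G A -> A *m v = 0 ->
  {in B, forall i, v i 0 = 0} -> psd_force G B W u w -> v w 0 = 0.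
Proof.
move=> [psdA adjA] Av0 vB /and4P[/componentsP[x xB defW] uB wW /eqP forceW].
have WB i : i \in W -> i \notin B by rewrite defW !inE => /andP[].
have A_edge i j : i != j -> (A i j != 0) = G i j.
  by move=> ij; rewrite -adjA /mx_adj /= ij.
have A_off i j : i \in W -> j \notin W -> j \notin B -> A i j = 0.
  move=> iW jW jB; apply/eqP/negPn; rewrite A_edge; last first.
    by apply: contraNneq jW => <-.
  apply: contra jW => ij; move: (iW); rewrite defW !inE jB => /andP[iB xi] /=.
  by apply: connect_trans xi (connect1 _); rewrite /minus_adj /= iB jB.
pose v' : 'cV[C]_n := \col_i (if i \in W then v i 0 else 0).
have Av'W i : i \in W -> (A *m v') i 0 = 0.
  move=> iW; transitivity ((A *m v) i 0); last by rewrite Av0 mxE.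
  rewrite !mxE; apply: eq_bigr => j _; rewrite !mxE.
  have [//|jW] := boolP (j \in W); have [/vB -> //|jB] := boolP (j \in B).
  by rewrite A_off // !mul0r.
have Av'0 : A *m v' = 0.
  apply: psdmx_form_eq0 => //; rewrite -mulmxA mxE big1 // => i _.
  have [/Av'W ->|iW] := boolP (i \in W); first by rewrite mulr0.
  by rewrite !mxE (negPf iW) conjC0 mul0r.
have wu : G u w.
  by have /setP/(_ w) := forceW; rewrite !inE eqxx => /andP[_ /andP[]].
(* [G] does not control the diagonal of [A]; as [u] is black and [W] white, row [u] meets [W] only
   off the diagonal. *)
have neq_uW j : j \in W -> u != j.
  by move=> /WB; apply: contraNneq => <-.
have : (A *m v') u 0 = A u w * v w 0.
  rewrite mxE (bigD1 w) //= mxE wW big1 ?addr0 // => j jw; rewrite mxE.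
  have [jW|_] := boolP (j \in W); last by rewrite mulr0.
  (* A nonzero [A u j] would make [j] a second white neighbor of [u] in [W]. *)
  have [->|Auj] := eqVneq (A u j) 0; first by rewrite mul0r.
  have /setP/(_ j) := forceW; rewrite !inE jW WB // (negPf jw).
  by rewrite -A_edge ?Auj ?neq_uW.
rewrite Av'0 mxE => /esym/eqP; rewrite mulf_eq0 => /orP[Auw|/eqP //].
by move: wu; rewrite -A_edge ?neq_uW ?Auw.
Qed.

Lemma psd_zfs_kernel A v X : Hplus G A -> psd_zfs G X -> A *m v = 0 ->
  {in X, forall i, v i 0 = 0} -> v = 0.
Proof.
move=> HA /connectP[p pX eT] Av0 vX.
suff vT : {in [set: 'I_n], forall i, v i 0 = 0}.
  by apply/matrixP => i j; rewrite ord1 mxE vT.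
rewrite eT; elim: p X vX pX {eT} => //= Y p IHp X vX /andP[stXY]; apply: IHp.
case/existsP: stXY => W /existsP[u /existsP[w /andP[forceW /eqP ->]]].
by move=> i /setU1P[->|/vX //]; apply: (psd_force_kernel HA Av0 vX forceW).
Qed.

Lemma nullity_le_zfs A X : Hplus G A -> psd_zfs G X -> (nullity A <= #|X|)%N.
Proof.
move=> HA zX; pose K := cokermx A.
pose KX := rowsub (enum_val : 'I_#|X| -> 'I_n) K.
(* Keeping only the rows of [K] indexed by [X] loses no rank: each column of [K *m cokermx KX] is a
   kernel vector of [A] vanishing on [X], hence zero, so the row space of [K] lies in that of
   [KX]. *)
apply: leq_trans (rank_leq_row KX); apply: mxrankS; rewrite submxE.
apply/eqP/matrixP => k j; rewrite [RHS]mxE.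
suff /matrixP/(_ k 0) : col j (K *m cokermx KX) = 0 by rewrite !mxE.
apply: (psd_zfs_kernel HA zX) => [|i iX].
  by rewrite colE -mulmxA (mulmxA A K) [A *m K]mulmx_coker mul0mx.
(* For [i] in [X], row [i] of [K] is the row of [KX] at the rank of [i] in [X]. *)
have /matrixP/(_ (enum_rank_in iX i) j) := mulmx_coker KX.
rewrite mxE [RHS]mxE => KX0; rewrite mxE mxE; apply: etrans KX0.
by apply: eq_bigr => l _; rewrite [KX _ _]mxE enum_rankK_in.
Qed.

End Kernel.

Theorem theorem3p5 (R : realType) (n : nat) (hn : (0 < n)%N) (G : sgraph n) :
  (@Mplus (complex R) n G <= Zplus G)%N.
Proof.
have [A HA <-] := Mplus_attained (complex R) G.
rewrite /Zplus; case: arg_minnP => [|X zX _]; first exact: psd_zfsT.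
exact: nullity_le_zfs HA zX.
Qed.
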